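(* For every prime power $q$, there exist six lines of $\mathrm{PG}(4,q)$ in higgledy-piggledy arrangement, two of which intersect.
   Context: $\mathrm{PG}(N,q)$ denotes the Desarguesian projective space of dimension $N$ over $\mathbb{F}_q$. For $k\in\{0,1,\dots,N-1\}$, a strong $k$-blocking set of $\mathrm{PG}(N,q)$ is a point set that meets every $(N-k)$-dimensional subspace $\kappa$ in a set of points spanning $\kappa$. A set $\mathcal{K}$ of $k$-subspaces of $\mathrm{PG}(N,q)$ is a higgledy-piggledy set (its elements are in higgledy-piggledy arrangement) if the set of all points lying in at least one element of $\mathcal{K}$ is a strong $k$-blocking set. *)

(* Defs.v *)
From HB Require Import structures.
From mathcomp Require Export all_boot all_order all_algebra.

Set Implicit Arguments.
Unset Strict Implicit.
Unset Printing Implicit Defensive.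

Import GRing.Theory VectorInternalTheory.

Definition is_prime_power (q : nat) : Prop :=
  exists p e : nat, [/\ prime p, (0 < e)%N & q = (p ^ e)%N].

(* VectorInternalTheory supplies the subType instance of {vspace vT} needed
   here. *)
HB.instance Definition _ (F : finFieldType) (vT : vectType F) :=
  [Countable of {vspace vT} by <:].
HB.instance Definition _ (F : finFieldType) (vT : vectType F) :=
  [Finite of {vspace vT} by <:].

(* PG(N, q) is the lattice of subspaces of F ^ (N + 1), where #|F| = q.
   A k-subspace has projective dimension k, hence vector space dimension
   k + 1. *)
Definition pg_subspace (F : finFieldType) (N k : nat) :=
  {U : {vspace 'rV[F]_N.+1} | \dim U == k.+1}.

Definition pg_point (F : finFieldType) (N : nat) := pg_subspace F N 0.
Definition pg_line (F : finFieldType) (N : nat) := pg_subspace F N 1.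

HB.instance Definition _ (F : finFieldType) (N k : nat) :=
  Finite.on (pg_subspace F N k).
HB.instance Definition _ (F : finFieldType) (N : nat) :=
  Finite.on (pg_point F N).
HB.instance Definition _ (F : finFieldType) (N : nat) :=
  Finite.on (pg_line F N).

Definition on_subspace (F : finFieldType) (N k : nat)
    (P : pg_point F N) (U : pg_subspace F N k) : bool :=
  (val P <= val U)%VS.

(* The subspace spanned by a set of points (the zero space if it is empty). *)
Definition pg_span (F : finFieldType) (N : nat) (S : {set pg_point F N})
    : {vspace 'rV[F]_N.+1} :=
  (\sum_(P in S) val P)%VS.

(* Meant for k < N: the subtraction N - k is truncated. *)
Definition strong_blocking_set (F : finFieldType) (N k : nat)
    (B : {set pg_point F N}) : Prop :=
  forall kappa : pg_subspace F N (N - k),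
    pg_span [set P in B | on_subspace P kappa] = val kappa.

Definition covered_points (F : finFieldType) (N k : nat)
    (K : {set pg_subspace F N k}) : {set pg_point F N} :=
  [set P | [exists U in K, on_subspace P U]].

Definition higgledy_piggledy (F : finFieldType) (N k : nat)
    (K : {set pg_subspace F N k}) : Prop :=
  strong_blocking_set k (covered_points K).

Definition pg_intersect (F : finFieldType) (N k l : nat)
    (U : pg_subspace F N k) (W : pg_subspace F N l) : Prop :=
  exists P : pg_point F N, on_subspace P U /\ on_subspace P W.

(* Main.v *)
Require Import Defs.
From mathcomp Require Import ring.

(**
  A set of lines is higgledy-piggledy as soon as no two non-proportional
  functionals h, g are such that h x = 0 implies g x = 0 at all of its points:
  take for h an equation of the hyperplane and for g a functional vanishing on
  the span of the covered points of that hyperplane.  On a line <v, w> this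
  implication makes the minor h(v) g(w) - h(w) g(v) vanish, which is a linear
  equation in the Plücker coordinates p_ij = h_i g_j - h_j g_i.

  Take the lines <e0, e1> and <e0, e2>, which meet in <e0>, and four lines of
  the form <e3 + a, e4 + b> with a, b in <e0, e1, e2>.  If q > 2, then z^3 - z
  and z^2 + z are not injective on F_q, hence miss values; this gives c and d
  such that z^3 - z - c and z^2 + z + d have no root.  With any w other than 0
  and 1, four lines are chosen so that the six linear equations amount to
    p01 = p02 = p34 = 0,  p14 = p04 + c p03 - d p12,
    p24 = p13 + p12,  p23 = p12 + p04,
  and the Plücker relations turn a nonzero solution into a root of one of the
  two polynomials.  If q = 2, there is no such w, and the implication itself is
  checked for four lines through <e4>.
*)

Set Implicit Arguments.
Unset Strict Implicit.
Unset Printing Implicit Defensive.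

Import GRing.Theory.
Local Open Scope ring_scope.

(** * Functionals and hyperplanes *)

(** The columns of the cokernel of a matrix with row space [U] have [U] as their set of common
    zeros, so one of them is nonzero at [v]. *)
Lemma separating_functional (F : fieldType) (n : nat)
    (U : {vspace 'rV[F]_n}) (v : 'rV[F]_n) :
  v \notin U ->
  exists2 h : 'cV[F]_n, {in U, forall u, u *m h = 0} & v *m h != 0.
Proof.
move=> vU.
pose A : 'M[F]_(\dim U, n) := \matrix_(i < \dim U) (vbasis U)`_i.
have rowA i : row i A = (vbasis U)`_i by rewrite rowK.
have inA u : (u <= A)%MS = (u \in U).
  apply/idP/idP => [/submxP[D ->]|uU].
    rewrite mulmx_sum_row memv_suml // => i _.
    by rewrite memvZ // rowA vbasis_mem // mem_nth // size_tuple.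
  rewrite (coord_vbasis uU) summx_sub // => i _.
  by rewrite scalemx_sub // -rowA row_sub.
have: v *m cokermx A != 0 by rewrite -submxE inA.
case/rV0Pn=> j vj.
have colE u : u *m col j (cokermx A) = col j (u *m cokermx A).
  by rewrite !colE mulmxA.
exists (col j (cokermx A)) => [u|].
  by rewrite -inA submxE colE => /eqP->; rewrite col0.
by apply: contraNneq vj => /rowP/(_ 0); rewrite colE !mxE => ->.
Qed.

Lemma higgledy_piggledy_of_functionals (F : finFieldType) (N : nat)
    (K : {set pg_line F N.+1}) :
  (forall h g : 'cV[F]_N.+2, h != 0 ->
     (forall (L : pg_line F N.+1) x,
        L \in K -> x \in val L -> x *m h = 0 -> x *m g = 0) ->
     forall x : 'rV_N.+2, x *m h = 0 -> x *m g = 0) ->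
  higgledy_piggledy K.
Proof.
move=> crit kappa; set S := pg_span _.
have sSk : (S <= val kappa)%VS.
  by apply/subv_sumP => P; rewrite inE => /andP[].
apply/eqP; rewrite eqEsubv sSk /=; apply/subvP => y yk.
apply/negPn/negP => yS.
have dk : \dim (val kappa) = N.+1.
  by rewrite (eqP (valP kappa)) subn1.
have [v _ vk] : exists2 v, v \in fullv & v \notin val kappa.
  apply/subvPn/negP => /dimvS.
  by rewrite dk dimvf /dim /= mul1n ltnn.
have [h hk hv] := separating_functional vk.
have [g gS gy] := separating_functional yS.
(* The hyperplane [kappa] and [v] span the whole space, so the kernel of [h] is no larger than
   [kappa]. *)
have kerh x : x *m h = 0 -> x \in val kappa.
  have full : (val kappa + <[v]> = fullv)%VS.
    apply/eqP; rewrite eqEdim subvf dimvf /dim /= mul1n.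
    rewrite dimv_disjoint_sum; last first.
      apply/eqP; rewrite -subv0; apply/subvP => z; rewrite memv_cap memv0.
      case/andP=> zk /vlineP[a za]; move: zk; rewrite za.
      have [->|a0] := eqVneq a 0; first by rewrite scale0r.
      by move/(memvZ a^-1); rewrite scalerK // (negPf vk).
    by rewrite dk dim_vline (memPnC vk) ?mem0v // addn1.
  have : x \in (val kappa + <[v]>)%VS by rewrite full memvf.
  case/memv_addP=> k kk [_ /vlineP[a ->] ->].
  rewrite mulmxDl hk // add0r -scalemxAl => /eqP.
  by rewrite scaler_eq0 (negPf hv) orbF => /eqP->; rewrite scale0r addr0.
have h0 : h != 0 by apply: contraNneq hv => ->; rewrite mulmx0.
(* A nonzero zero of [h] on a line of [K] spans a covered point of [kappa], hence lies in [S], where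
   [g] vanishes. *)
case/negP: gy; apply/eqP; apply: (crit h g h0) (hk _ yk) => L x LK xL hx.
have [->|x0] := eqVneq x 0; first by rewrite mul0mx.
have dx : \dim <[x]> == 1%N by rewrite dim_vline x0.
apply: gS; have : (val (exist _ <[x]>%VS dx : pg_point F N.+1) <= S)%VS.
  apply: (sumv_sup (exist _ <[x]>%VS dx)); last exact: subvv.
  rewrite !inE /on_subspace /= -memvE kerh // andbT.
  by apply/existsP; exists L; rewrite LK /= -memvE.
by rewrite /= -memvE.
Qed.

(** * Plücker relations *)

(* The five quadratic hypotheses are the Plücker relations of the lines of
   PG(4, q). *)
Lemma plucker_vanish (F : fieldType) (c d : F)
    (p01 p02 p03 p04 p12 p13 p14 p23 p24 p34 : F) :
  (forall z, z ^+ 3 != z + c) -> (forall z, z ^+ 2 + z + d != 0) ->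
  p01 * p23 - p02 * p13 + p03 * p12 = 0 ->
  p01 * p24 - p02 * p14 + p04 * p12 = 0 ->
  p01 * p34 - p03 * p14 + p04 * p13 = 0 ->
  p02 * p34 - p03 * p24 + p04 * p23 = 0 ->
  p12 * p34 - p13 * p24 + p14 * p23 = 0 ->
  p01 = 0 -> p02 = 0 -> p34 = 0 ->
  p14 = p04 + c * p03 - d * p12 -> p24 = p13 + p12 -> p23 = p12 + p04 ->
  [/\ p03 = 0, p04 = 0, p12 = 0 & p13 = 0].
Proof.
move=> cubic quadratic R1 R2 R3 R4 R5 E01 E02 E34 E14 E24 E23.
subst p01 p02 p34 p14 p24 p23.
(* If [p12] is nonzero, [R1] and [R2] kill [p03] and [p04], and [R5] makes [p13 / p12] a root of the
   quadratic. *)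
have [p12_0|p12_neq0] := eqVneq p12 0; last first.
  have p03_0 : p03 = 0.
    by apply: (mulIf p12_neq0); rewrite mul0r -R1; ring.
  have p04_0 : p04 = 0.
    by apply: (mulIf p12_neq0); rewrite mul0r -R2; ring.
  have /eqP[] := quadratic (p13 / p12).
  subst p03 p04; apply: (mulIf (expf_neq0 2 p12_neq0)).
  by rewrite mul0r -[RHS]oppr0 -R5; field.
subst p12.
(* Now [R4] reads [p03 * p13 = p04 ^+ 2]; multiplying by [p04] and using [R3] makes [p04 / p03] a
   root of the cubic unless [p03 = 0]. *)
have root_cubic : p04 ^+ 3 = (p04 + c * p03) * p03 ^+ 2.
  have -> : p04 ^+ 3 = p04 * (p03 * p13).
    have -> : p03 * p13 = p04 ^+ 2.
      by apply/eqP; rewrite -subr_eq0 -oppr_eq0 -R4; apply/eqP; ring.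
    by ring.
  have -> : p04 * (p03 * p13) = p03 * (p04 * p13) by ring.
  have -> : p04 * p13 = p03 * (p04 + c * p03).
    by apply/eqP; rewrite -subr_eq0 -R3; apply/eqP; ring.
  by ring.
have p03_0 : p03 = 0.
  apply/eqP/negPn/negP => p03_neq0; have /eqP[] := cubic (p04 / p03).
  apply: (mulIf (expf_neq0 3 p03_neq0)).
  transitivity (p04 ^+ 3); first by field.
  by rewrite root_cubic; field.
subst p03.
have p04_0 : p04 = 0.
  have : p04 ^+ 3 == 0 by rewrite root_cubic expr0n mulr0.
  by rewrite expf_eq0 => /eqP.
subst p04; split=> //.
have : p13 ^+ 2 == 0 by rewrite -oppr_eq0 -R5; apply/eqP; ring.
by rewrite expf_eq0 => /eqP.
Qed.

(** * Six lines in coordinates *)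

Lemma card_set_seq (T : finType) (s : seq T) :
  uniq s -> #|[set x in s]| = size s.
Proof. by move=> s_uniq; rewrite cardsE; apply/card_uniqP. Qed.

Definition row5 (F : fieldType) (a b c d e : F) : 'rV[F]_5 :=
  \row_(i < 5) [:: a; b; c; d; e]`_i.

Lemma mul_row5 (F : fieldType) (a b c d e : F) (h : 'cV[F]_5) :
  (row5 a b c d e *m h) 0 0 =
    a * h (inord 0) 0 + b * h (inord 1) 0 + c * h (inord 2) 0
      + d * h (inord 3) 0 + e * h (inord 4) 0.
Proof.
rewrite mxE !big_ord_recr big_ord0 /= add0r !mxE /=.
by do 4?congr (_ + _); congr (_ * h _ 0); apply/val_inj; rewrite /= inordK.
Qed.

Lemma memv_span2P (F : fieldType) (vT : vectType F) (v w u : vT) :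
  reflect (exists x y, u = x *: v + y *: w) (u \in <<[:: v; w]>>%VS).
Proof.
rewrite span_cons span_seq1; apply: (iffP memv_addP).
  by case=> _ /vlineP[x ->] [_ /vlineP[y ->] ->]; exists x, y.
by case=> x [y ->]; exists (x *: v); rewrite ?memvZ ?memv_line //;
  exists (y *: w); rewrite ?memvZ ?memv_line.
Qed.

Lemma dim_span2 (F : fieldType) (n : nat) (v w : 'rV[F]_n) (i j : 'I_n) :
  v 0 i * w 0 j != v 0 j * w 0 i -> \dim <<[:: v; w]>>%VS == 2.
Proof.
move=> minor; rewrite -/(free [:: v; w]).
rewrite free_cons free_cons nil_free span_nil memv0 andbT span_seq1.
apply/andP; split.
  apply: contraNN minor => /vlineP[a ->]; rewrite !mxE; apply/eqP; ring.
by apply: contraNneq minor => ->; rewrite !mxE !mulr0.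
Qed.

(** The arguments are the values of two functionals [h] and [g] at two vectors spanning a line. *)
Definition vanishing_on (F : fieldType) (h1 h2 g1 g2 : F) : Prop :=
  forall x y, x * h1 + y * h2 = 0 -> x * g1 + y * g2 = 0.

(** The value at [a] in <e0, e1, e2> of the functional taking the value [h i] at each e_i. *)
Definition ev3 (F : fieldType) (a : F * F * F) (h : nat -> F) : F :=
  a.1.1 * h 0%N + a.1.2 * h 1%N + a.2 * h 2%N.

Section SixLines.
Variable F : finFieldType.

Definition basis01 : pg_line F 4.
Proof.
exists <<[:: row5 1 0 0 0 0; row5 0 1 0 0 0]>>%VS.
apply: (@dim_span2 _ _ _ _ (inord 0) (inord 1)).
by rewrite !mxE !inordK //= mulr0 mulr1 oner_neq0.
Defined.

Definition basis02 : pg_line F 4.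
Proof.
exists <<[:: row5 1 0 0 0 0; row5 0 0 1 0 0]>>%VS.
apply: (@dim_span2 _ _ _ _ (inord 0) (inord 2)).
by rewrite !mxE !inordK //= mulr0 mulr1 oner_neq0.
Defined.

Definition graph_line (ab : (F * F * F) * (F * F * F)) : pg_line F 4.
Proof.
exists <<[:: row5 ab.1.1.1 ab.1.1.2 ab.1.2 1 0;
             row5 ab.2.1.1 ab.2.1.2 ab.2.2 0 1]>>%VS.
apply: (@dim_span2 _ _ _ _ (inord 3) (inord 4)).
by rewrite !mxE !inordK //= mulr0 mulr1 oner_neq0.
Defined.

Lemma six_lines (s : seq ((F * F * F) * (F * F * F))) :
  size s = 4 -> uniq (map fst s) ->
  (forall h g : nat -> F,
     vanishing_on (h 0%N) (h 1%N) (g 0%N) (g 1%N) ->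
     vanishing_on (h 0%N) (h 2%N) (g 0%N) (g 2%N) ->
     {in s, forall ab,
       vanishing_on (ev3 ab.1 h + h 3%N) (ev3 ab.2 h + h 4%N)
                    (ev3 ab.1 g + g 3%N) (ev3 ab.2 g + g 4%N)} ->
     forall i j : 'I_5, h i * g j = h j * g i) ->
  exists K : {set pg_line F 4},
    [/\ #|K| = 6,
        higgledy_piggledy K
      & exists L M : pg_line F 4,
          [/\ L \in K, M \in K, L <> M & pg_intersect L M]].
Proof.
move=> size_s uniq_s crit.
have coord_eq (u v : 'rV[F]_5) k : u = v -> u 0 (inord k) = v 0 (inord k).
  by move->.
have e0_graph ab : row5 1 0 0 0 0 \notin val (graph_line ab).
  apply/negP => /memv_span2P[x [y E]].
  have := coord_eq _ _ 3 E; have := coord_eq _ _ 4 E; have := coord_eq _ _ 0%N E.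
  rewrite !mxE !inordK //= !mulr0 !mulr1 addr0 add0r => E0 y0 x0.
  by move/eqP: E0; rewrite -x0 -y0 !mul0r addr0 oner_eq0.
have e0_01 : row5 1 0 0 0 0 \in val basis01 by rewrite memv_span ?mem_head.
have e0_02 : row5 1 0 0 0 0 \in val basis02 by rewrite memv_span ?mem_head.
have graph_inj ab cd : graph_line ab = graph_line cd -> ab.1 = cd.1.
  move=> E.
  have : row5 ab.1.1.1 ab.1.1.2 ab.1.2 1 0 \in val (graph_line cd).
    by rewrite -E memv_span ?mem_head.
  case/memv_span2P=> x [y {}E].
  have := coord_eq _ _ 0%N E; have := coord_eq _ _ 1%N E.
  have := coord_eq _ _ 2 E; have := coord_eq _ _ 3 E; have := coord_eq _ _ 4 E.
  rewrite !mxE !inordK //= !mulr0 !mulr1 addr0 add0r => <- <-.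
  rewrite !mul1r !mul0r !addr0.
  by case: ab.1 cd.1 => [[? ?] ?] [[? ?] ?] /= -> -> ->.
have neq : basis01 != basis02.
  apply/eqP => E; have : row5 0 1 0 0 0 \in val basis02.
    by rewrite -E memv_span // !inE eqxx orbT.
  case/memv_span2P=> x [y {}E]; have := coord_eq _ _ 1%N E.
  by rewrite !mxE !inordK //= !mulr0 addr0 => /eqP; rewrite oner_eq0.
have e0_neq (U : pg_line F 4) ab :
    row5 1 0 0 0 0 \in val U -> U != graph_line ab.
  by move=> e0U; apply: contraTneq e0U => ->; apply: e0_graph.
pose t := [:: basis01, basis02 & map graph_line s].
exists [set L in t]; split; last first.
- exists basis01, basis02; split; rewrite ?inE ?eqxx ?orbT //; first exact/eqP.
  have d1 : \dim <[row5 1 0 0 0 0 : 'rV[F]_5]>%VS == 1%N.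
    rewrite dim_vline eqb1; apply/eqP => E; have := coord_eq _ _ 0%N E.
    by rewrite !mxE inordK //= => /eqP; rewrite oner_eq0.
  exists (exist _ <[row5 1 0 0 0 0]>%VS d1 : pg_point F 4).
  by rewrite /on_subspace /= -!memvE.
- apply: higgledy_piggledy_of_functionals => h g h_neq0 van x hx.
  pose H k := h (inord k) 0; pose G k := g (inord k) 0.
  have van_span (L : pg_line F 4) v w : L \in t -> val L = <<[:: v; w]>>%VS ->
      vanishing_on ((v *m h) 0 0) ((w *m h) 0 0) ((v *m g) 0 0) ((w *m g) 0 0).
    move=> Lt defL y z hyz; have lin (f : 'cV[F]_5) :
        ((y *: v + z *: w) *m f) 0 0 = y * (v *m f) 0 0 + z * (w *m f) 0 0.
      by rewrite mulmxDl -!scalemxAl !mxE.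
    rewrite -lin (van L) ?mxE // ?inE // ?defL.
      by apply/memv_span2P; exists y, z.
    by apply/matrixP => i j; rewrite !ord1 lin hyz mxE.
  have prop : forall i j : 'I_5, H i * G j = H j * G i.
    apply: crit => [||ab s_ab].
    + have := van_span basis01 _ _ (mem_head _ _) (erefl _).
      by rewrite !mul_row5 !mul0r !mul1r !addr0 !add0r.
    + have := van_span basis02 _ _ _ (erefl _).
      rewrite !mul_row5 !mul0r !mul1r !addr0 !add0r; apply.
      by rewrite !inE eqxx orbT.
    + have := van_span (graph_line ab) _ _ _ (erefl _).
      rewrite !mul_row5 !mul0r !mul1r !addr0; apply.
      by do 2!apply: mem_behead; apply: map_f.
  (* Proportionality gives [h_k * (x *m g) = g_k * (x *m h) = 0], and [h_k] can be cancelled. *)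
  have [k hk] : exists k, h k 0 != 0.
    by case/cV0Pn: h_neq0 => k; exists k.
  apply/matrixP => i j; rewrite !ord1 {i j} [RHS]mxE; apply: (mulfI hk).
  rewrite mulr0 mxE mulr_sumr.
  under eq_bigr => i _.
    have -> : h k 0 * (x 0 i * g i 0) = x 0 i * h i 0 * g k 0.
      have := prop k i; rewrite /H /G !inord_val => E.
      by rewrite mulrCA E mulrA.
    over.
  move/matrixP/(_ 0 0): hx; rewrite -mulr_suml !mxE => ->.
  by rewrite mul0r.
have t_uniq : uniq t.
  rewrite /= !inE (negPf neq) /=; apply/and3P; split.
  - by apply/mapP => -[ab _ E]; move: (e0_neq _ ab e0_01); rewrite E eqxx.
  - by apply/mapP => -[ab _ E]; move: (e0_neq _ ab e0_02); rewrite E eqxx.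
  - elim: (s) uniq_s => //= ab s' IHs /andP[ab_s' /IHs->]; rewrite andbT.
    by apply: contra ab_s' => /mapP[cd s'_cd /graph_inj->]; apply: map_f.
by rewrite (card_set_seq t_uniq) /= size_map size_s.
Qed.
End SixLines.

(** * Fields with more than two elements *)

Lemma vanishing_on_minor (F : fieldType) (h1 h2 g1 g2 : F) :
  vanishing_on h1 h2 g1 g2 -> h1 * g2 - h2 * g1 = 0.
Proof.
move=> /(_ h2 (- h1)) van; apply/eqP.
rewrite -oppr_eq0 -[X in _ == X]van; last ring.
by apply/eqP; ring.
Qed.

Lemma minors_proportional (F : fieldType) (h g : nat -> F) :
  (forall i j, (i < j < 5)%N -> h i * g j - h j * g i = 0) ->
  forall i j : 'I_5, h i * g j = h j * g i.
Proof.
move=> minor i j; have [ij|ji|->//] := ltngtP i j.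
  by apply/eqP; rewrite -subr_eq0 minor // ij ltn_ord.
by apply/esym/eqP; rewrite -subr_eq0 minor // ji ltn_ord.
Qed.

(** All four triples [(al, be, ga)] satisfy [al * ga - be ^+ 2 = ga + d * al - be]. The first is
    zero and isolates [p34]; the other three are linearly independent when [w] is neither 0 nor
    1. *)
Definition generic_lines (F : fieldType) (c d w : F) :
    seq ((F * F * F) * (F * F * F)) :=
  let line al be ga := ((ga - al, al, be), (c * al, be, ga)) in
  [:: line 0 0 0; line 0 1 0; line 0 w (w - w ^+ 2); line (1 - w) 0 (d - d / w)].

Lemma generic_lines_rigid (F : fieldType) (c d w : F) (h g : nat -> F) :
  (forall z, z ^+ 3 != z + c) -> (forall z, z ^+ 2 + z + d != 0) ->
  w != 0 -> w != 1 ->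
  vanishing_on (h 0%N) (h 1%N) (g 0%N) (g 1%N) ->
  vanishing_on (h 0%N) (h 2%N) (g 0%N) (g 2%N) ->
  {in generic_lines c d w, forall ab,
    vanishing_on (ev3 ab.1 h + h 3%N) (ev3 ab.2 h + h 4%N)
                 (ev3 ab.1 g + g 3%N) (ev3 ab.2 g + g 4%N)} ->
  forall i j : 'I_5, h i * g j = h j * g i.
Proof.
move=> cubic quadratic w0 w1.
move=> /vanishing_on_minor M01 /vanishing_on_minor M02 van.
pose p i j := h i * g j - h j * g i.
have p01 : p 0%N 1%N = 0 by [].
have p02 : p 0%N 2 = 0 by [].
have p34 : p 3 4 = 0.
  have := vanishing_on_minor (van _ (mem_head _ _)).
  by rewrite /ev3 /= => <-; rewrite /p; ring.
pose E1 := p 1%N 4 - p 0%N 4 - c * p 0%N 3 + d * p 1%N 2.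
pose E2 := p 2 4 - p 1%N 3 - p 1%N 2.
pose E3 := p 1%N 2 - p 2 3 + p 0%N 4.
(* Under the normalisation [al * ga - be ^+ 2 = ga + d * al - be], the minor of
   the line with parameters [al], [be], [ga] is linear in these parameters. *)
have line_eq al be ga : al * ga - be ^+ 2 = ga + d * al - be ->
    (ga - al, al, be, (c * al, be, ga)) \in generic_lines c d w ->
    al * E1 + be * E2 + ga * E3 = 0.
  move=> norm /van /vanishing_on_minor /=; rewrite /ev3 /=.
  set m := (X in X = 0) => m0.
  transitivity (m - ((ga - al) * be - al * (c * al)) * p 0%N 1%N
      - ((ga - al) * ga - be * (c * al)) * p 0%N 2 - p 3 4
      - (al * ga - be ^+ 2 - (ga + d * al - be)) * p 1%N 2).
    by rewrite /m /E1 /E2 /E3 /p; ring.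
  by rewrite norm m0 p01 p02 p34 subrr mul0r !mulr0 !subr0.
have L1 : 0 * E1 + 1 * E2 + 0 * E3 = 0.
  by apply: line_eq; [ring | rewrite !inE eqxx orbT].
have L2 : 0 * E1 + w * E2 + (w - w ^+ 2) * E3 = 0.
  by apply: line_eq; [ring | rewrite !inE eqxx !orbT].
have L3 : (1 - w) * E1 + 0 * E2 + (d - d / w) * E3 = 0.
  by apply: line_eq; [field | rewrite !inE eqxx !orbT].
have E2_0 : E2 = 0 by rewrite -L1; ring.
have w1' : 1 - w != 0 by rewrite subr_eq0 eq_sym.
have E3_0 : E3 = 0.
  by apply: (mulfI (mulf_neq0 w0 w1')); rewrite mulr0 -L2 E2_0; ring.
have E1_0 : E1 = 0.
  by apply: (mulfI w1'); rewrite mulr0 -L3 E2_0 E3_0; ring.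
have p14 : p 1%N 4 = p 0%N 4 + c * p 0%N 3 - d * p 1%N 2.
  by rewrite -[RHS]addr0 -E1_0 /E1; ring.
have p24 : p 2 4 = p 1%N 3 + p 1%N 2 by rewrite -[RHS]addr0 -E2_0 /E2; ring.
have p23 : p 2 3 = p 1%N 2 + p 0%N 4 by rewrite -[RHS]subr0 -E3_0 /E3; ring.
(* The side goals are the Plücker relations, polynomial identities for the minors [p i j]. *)
have [||||| p03 p04 p12 p13] := plucker_vanish cubic quadratic _ _ _ _ _
  p01 p02 p34 p14 p24 p23; try by rewrite /p; ring.
apply: minors_proportional => i j; rewrite -/(p i j).
case: i j => [|[|[|[|i]]]] [|[|[|[|[|j]]]]] /andP[] //= _ _.
all: by rewrite ?(p14, p24, p23) ?(p01, p02, p03, p04, p12, p13, p34); ring.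
Qed.

(** * The field with two elements *)

Definition binary_lines (F : fieldType) : seq ((F * F * F) * (F * F * F)) :=
  [:: ((0, 0, 0), (0, 0, 0)); ((0, 1, 0), (0, 0, 0));
      ((0, 0, 1), (0, 0, 0)); ((1, 1, 1), (0, 0, 0))].

(** The contrapositive of [vanishing_on] over two elements, at the three points (1, 0), (0, 1) and
    (1, 1) of the line. *)
Definition bvanishing_on (h1 h2 g1 g2 : bool) : bool :=
  [&& g1 ==> h1, g2 ==> h2 & (g1 (+) g2) ==> (h1 (+) h2)].

Lemma boolean_rigid (h0 h1 h2 h3 h4 g0 g1 g2 g3 g4 : bool) :
  bvanishing_on h0 h1 g0 g1 -> bvanishing_on h0 h2 g0 g2 ->
  bvanishing_on h3 h4 g3 g4 ->
  bvanishing_on (h1 (+) h3) h4 (g1 (+) g3) g4 ->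
  bvanishing_on (h2 (+) h3) h4 (g2 (+) g3) g4 ->
  bvanishing_on (h0 (+) h1 (+) h2 (+) h3) h4 (g0 (+) g1 (+) g2 (+) g3) g4 ->
  let h := [:: h0; h1; h2; h3; h4] in let g := [:: g0; g1; g2; g3; g4] in
  all (fun i => all (fun j =>
    nth false h i && nth false g j == nth false h j && nth false g i)
    (iota 0 5)) (iota 0 5).
Proof.
by case: h0; case: h1; case: h2; case: h3; case: h4;
   case: g0; case: g1; case: g2; case: g3; case: g4.
Qed.

(** A surjective self-map of a finite type is injective. *)
Lemma missed_value (T : finType) (f : T -> T) (x y : T) :
  x != y -> f x = f y -> exists c, forall z, f z != c.
Proof.
move=> xy fxy; have [c /= fc|onto] := pickP [pred c | c \notin codom f].
  by exists c => z; apply: contraNneq fc => <-; apply: codom_f.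
have /image_injP inj : #|image f T| == #|T|.
  by apply/eqP/eq_card => c; have /negbFE := onto c.
by case/eqP: xy; apply: inj.
Qed.

Lemma binary_lines_rigid (F : fieldType) (h g : nat -> F) :
  (forall x : F, x = 0 \/ x = 1) ->
  vanishing_on (h 0%N) (h 1%N) (g 0%N) (g 1%N) ->
  vanishing_on (h 0%N) (h 2%N) (g 0%N) (g 2%N) ->
  {in binary_lines F, forall ab,
    vanishing_on (ev3 ab.1 h + h 3%N) (ev3 ab.2 h + h 4%N)
                 (ev3 ab.1 g + g 3%N) (ev3 ab.2 g + g 4%N)} ->
  forall i j : 'I_5, h i * g j = h j * g i.
Proof.
move=> F2 van01 van02 van.
have add11 : 1 + 1 = 0 :> F.
  by have [->//|/eqP] := F2 (1 + 1); rewrite -subr_eq0 addrK oner_eq0.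
(* This identifies [F] with the booleans, addition becoming exclusive or. *)
pose f (x : F) := x == 1.
have fD x y : f (x + y) = f x (+) f y.
  rewrite /f; have [->|->] := F2 x; have [->|->] := F2 y;
  by rewrite ?(add11, addr0, add0r, eqxx) // eq_sym oner_eq0.
have fE x : x = (f x)%:R.
  by rewrite /f; have [->|->] := F2 x; rewrite ?eqxx // eq_sym oner_eq0.
have fimp x y : (x = 0 -> y = 0) -> f y ==> f x.
  rewrite /f; have [->|->] := F2 x; last by rewrite eqxx implybT.
  by move=> ->; rewrite // eq_sym oner_eq0.
have fvan h1 h2 g1 g2 : vanishing_on h1 h2 g1 g2 ->
    bvanishing_on (f h1) (f h2) (f g1) (f g2).
  move=> v; apply/and3P; rewrite -!fD; split; apply: fimp.
  - by move: (v 1 0); rewrite !mul1r !mul0r !addr0.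
  - by move: (v 0 1); rewrite !mul1r !mul0r !add0r.
  - by move: (v 1 1); rewrite !mul1r.
have hg := fvan _ _ _ _ (van (_, _, _, (_, _, _)) _).
have B3 := hg 0 0 0 0 0 0 ltac:(by rewrite !inE eqxx).
have B4 := hg 0 1 0 0 0 0 ltac:(by rewrite !inE eqxx ?orbT).
have B5 := hg 0 0 1 0 0 0 ltac:(by rewrite !inE eqxx ?orbT).
have B6 := hg 1 1 1 0 0 0 ltac:(by rewrite !inE eqxx ?orbT).
rewrite /ev3 /= !mul0r ?mul1r ?add0r ?addr0 ?fD in B3 B4 B5 B6.
have B1 := fvan _ _ _ _ van01; have B2 := fvan _ _ _ _ van02.
have prop := boolean_rigid B1 B2 B3 B4 B5 B6.
apply: minors_proportional => i j /andP[ij j5].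
have {}prop := allP (allP prop i _) j _.
rewrite !mem_iota (ltn_trans ij j5) j5 in prop.
move: prop => /(_ isT isT)/eqP.
have nthf (k : nat -> F) n : (n < 5)%N ->
    nth false [:: f (k 0%N); f (k 1%N); f (k 2); f (k 3); f (k 4)] n = f (k n).
  by case: n => [|[|[|[|[|n]]]]].
rewrite !nthf // ?(ltn_trans ij j5) // => E; apply/eqP; rewrite subr_eq0.
by rewrite (fE (h i)) (fE (h j)) (fE (g i)) (fE (g j)) -!natrM !mulnb E.
Qed.

Theorem mainTheorem1 (q : nat) (hq : is_prime_power q)
    (F : finFieldType) (hF : #|F| = q) :
  exists K : {set pg_line F 4},
    [/\ #|K| = 6,
        higgledy_piggledy K
      & exists L M : pg_line F 4,
          [/\ L \in K, M \in K, L <> M & pg_intersect L M]].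
Proof.
have ne10 : (1 : F) != 0 := oner_neq0 F.
have [w|F2] := pickP [pred w : F | (w != 0) && (w != 1)].
  case/andP=> w0 w1.
  have [d quadratic] : exists d : F, forall z, z ^+ 2 + z + d != 0.
    (* The map z^2 + z vanishes at both 0 and -1, and z^3 - z below at both 0 and 1. *)
    have [||d dP] := @missed_value F (fun z => z ^+ 2 + z) 0 (- 1).
    - by rewrite eq_sym oppr_eq0.
    - ring.
    by exists (- d) => z; rewrite subr_eq0.
  have [c cubic] : exists c : F, forall z, z ^+ 3 != z + c.
    have [||c cP] := @missed_value F (fun z => z ^+ 3 - z) 0 1.
    - by rewrite eq_sym.
    - ring.
    by exists c => z; rewrite addrC -subr_eq.
  apply: (@six_lines F (generic_lines c d w)) => // [|h g]; last first.
    exact: generic_lines_rigid.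
  (* The first components end in 0, 1, [w], 0, and the two ending in 0 have middle entries 0 and
     [1 - w]. *)
  have w1' : 1 - w != 0 by rewrite subr_eq0 eq_sym.
  rewrite /= !inE !xpair_eqE !subr0 !negb_or.
  rewrite !(eq_sym 0) ![1 == w]eq_sym.
  by rewrite ?(negPf w0, negPf w1, negPf w1', negPf ne10, eqxx, andbF).
apply: (@six_lines F (binary_lines F)) => // [|h g]; last first.
  apply: binary_lines_rigid => x; have := F2 x => /= /negbT.
  by rewrite negb_and !negbK => /orP[]/eqP; [left | right].
by rewrite /= !inE !xpair_eqE ![0 == 1]eq_sym ?(negPf ne10) ?andbF.
Qed.
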